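(* Consider the $T$-period token auction, with a given sequence of equilibrium prices, i.e. prices satisfying $p_t=\max\{\frac{\sum_{i} b_{i,t}}{M_t},\ \beta(1+\tau_t)p^e_{t+1}\}$ for all $t\le T$ (with $p^e_{T+1}=0$). Then at the beginning of each period $t\le T$ (before the period-$t$ valuations are drawn), the present-discounted value of the auctioneer's expected revenues from period $t$ onward, given the auctioneer's token holdings $A_t$ and the token supply $M_t$, is $$\Pi_{\mathrm{Tokens},t}(A_t)=\frac{1-\beta^{T-t+1}}{1-\beta}\,k-p^e_t\,(M_t-A_t),$$ where $p^e_t$ is the expected period-$t$ token price at the beginning of period $t$.
   Context: A single object is auctioned in each of the periods $1,\dots,T$ to $n\ge2$ risk-neutral bidders; the discount factor is $\beta\in(0,1)$ for everyone and there is a risk-free asset with gross return $R=1/\beta$. In each period every bidder $i$ draws a valuation $v_{i,t}>0$, independently across bidders and periods, from a continuous atomless distribution $F$ on $[\underline v,\overline v]$. The auction is a standard one with revenue-maximizing reservation price $\underline b$; by revenue equivalence the total dollar-denominated payment $\sum_i b_{i,t}\ge 0$ in period $t$ depends only on period-$t$ valuations and has expectation (conditional on the past) equal to $$k=\mathbb{E}\big[\max\{v_{\mathrm{Max}-1,t},\underline b\}\,\big|\,v_{\mathrm{Max},t}\ge\underline b\big]\cdot\Pr\{v_{\mathrm{Max},t}\ge\underline b\},$$ where $v_{\mathrm{Max},t}$ and $v_{\mathrm{Max}-1,t}$ are the highest and second-highest realized valuations. Tokens: at the start of period $t$ the auctioneer holds $A_t\ge0$ tokens and bidders hold $a_{i,t}\ge0$;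 the supply is $M_t=A_t+\sum_i a_{i,t}$, with $M_t>0$ for $t\le T$; initially $A_1=M_1$ and $a_{i,1}=0$. After period-$t$ payments $b_{i,t}$ are determined, a token market opens at price $p_t$. The auctioneer's net purchase is $Q_t$ and bidder $i$'s is $q_{i,t}$, with $Q_t+\sum_i q_{i,t}=0$, $A_t+Q_t\ge0$ and $a_{i,t}+q_{i,t}\ge b_{i,t}/p_t$. Then each bidder transfers $b_{i,t}/p_t$ tokens to the auctioneer. The auctioneer's period-$t$ revenue is $-p_tQ_t$. The speculative demand is $S_t=M_t-\sum_i b_{i,t}/p_t$, the number of tokens not used for payment. The monetary policy is a fixed sequence $(\tau_t,\sigma_t)$ with $\tau_t,\sigma_t\ge-1$, and holdings evolve as $$a_{i,t+1}=(1+\tau_t)\Big(a_{i,t}+q_{i,t}-\tfrac{b_{i,t}}{p_t}\Big),\qquad A_{t+1}=(1+\tau_t)\Big(A_t+Q_t+(1+\sigma_t)\sum_{i}\tfrac{b_{i,t}}{p_t}\Big).$$ $p^e_{t+1}$ denotes the expectation of $p_{t+1}$ conditional on information available in period $t$ (after period-$t$ valuations are realized), equivalently at the beginning of period $t+1$. After period $T$ tokens are worthless. *)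

(* Defs.v *)
From HB Require Import structures.
From mathcomp Require Import all_boot all_order all_algebra.
From mathcomp Require Import all_classical all_reals all_analysis.

Set Implicit Arguments.
Unset Strict Implicit.
Unset Printing Implicit Defensive.

Import Order.TTheory GRing.Theory Num.Theory.
Import numFieldNormedType.Exports.

Local Open Scope classical_set_scope.
Local Open Scope ring_scope.

(* A sub-sigma-algebra of Om is a set of measurable sets.  In a filtration
   [Fil], [Fil t] is the information available in period t once the period-t
   valuations are realized, which is also the information available at the
   beginning of period t.+1; [Fil 0] is the information available before the
   first draw. *)
Definition filtration d (Om : measurableType d)
    (Fil : nat -> set (set Om)) : Prop :=
  (forall t, sigma_algebra [set: Om] (Fil t) /\ Fil t `<=` measurable) /\
  (forall s t, (s <= t)%N -> Fil s `<=` Fil t).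

Definition measurable_wrt d (Om : measurableType d) (R : realType)
    (G : set (set Om)) (X : Om -> R) : Prop :=
  forall B : set R, measurable B -> G (X @^-1` B).

(* [Y] is a version of the conditional expectation of [X] given [G]; it is
   unique up to almost sure equality. *)
Definition is_cond_exp d (Om : measurableType d) (R : realType)
    (P : probability Om R) (G : set (set Om)) (X Y : Om -> R) : Prop :=
  [/\ P.-integrable [set: Om] (EFin \o X),
      P.-integrable [set: Om] (EFin \o Y),
      measurable_wrt G Y &
      forall E : set Om, G E ->
        (\int[P]_(w in E) (Y w)%:E = \int[P]_(w in E) (X w)%:E)%E].

(* Taking for [E] events about earlier draws, which are in [Fil t.-1] when
   [v] is adapted, this gives mutual independence of the whole family
   [v t i] (1 <= t <= T) across bidders and periods.  [E] may also be any
   other past information, e.g. past randomization by the players. *)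
Definition independent_draws d (Om : measurableType d) (R : realType)
    (P : probability Om R) (Fil : nat -> set (set Om)) (T n : nat)
    (v : nat -> 'I_n -> {RV P >-> R}) : Prop :=
  forall (t : nat) (E : set Om) (B : 'I_n -> set R),
    (1 <= t <= T)%N -> Fil t.-1 E -> (forall i, measurable (B i)) ->
    P (E `&` \bigcap_i (v t i @^-1` B i)) =
    (P E * \prod_(i < n) P (v t i @^-1` B i))%E.

Definition order_stat (R : realType) (n : nat) (x : 'I_n -> R) (j : nat) : R :=
  nth 0 (sort (fun y z => z <= y) [seq x i | i <- enum 'I_n]) j.

Definition highest (R : realType) (n : nat) (x : 'I_n -> R) : R :=
  order_stat x 0.

(* Ties count with multiplicity. *)
Definition second_highest (R : realType) (n : nat) (x : 'I_n -> R) : R :=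
  order_stat x 1.

(* E[X | E] for an event E, with value 0 when P(E) = 0. *)
Definition exp_given_event d (Om : measurableType d) (R : realType)
    (P : probability Om R) (X : Om -> R) (E : set Om) : R :=
  fine (\int[P]_(w in E) (X w)%:E)%E / fine (P E).

(* Expected one-period revenue of a standard auction among bidders with
   valuations [v] when the reservation price is [r]. *)
Definition auction_revenue d (Om : measurableType d) (R : realType)
    (P : probability Om R) (n : nat) (v : 'I_n -> Om -> R) (r : R) : R :=
  let sold := [set w | r <= highest (fun i => v i w)] in
  exp_given_event P
    (fun w => Num.max (second_highest (fun i => v i w)) r) sold
  * fine (P sold).

(* Equilibrium prices vanish only when the total payment vanishes; the token
   payments b / p are then 0 by the convention x / 0 = 0. *)
Definition total_payment (Om : Type) (R : realType) (n : nat)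
    (b : nat -> 'I_n -> Om -> R) (t : nat) (w : Om) : R :=
  \sum_(i < n) b t i w.

Definition supply (Om : Type) (R : realType) (n : nat)
    (A : nat -> Om -> R) (a : nat -> 'I_n -> Om -> R) (t : nat) (w : Om) : R :=
  A t w + \sum_(i < n) a t i w.

Definition period_revenue (Om : Type) (R : realType)
    (p Q : nat -> Om -> R) (t : nat) (w : Om) : R :=
  - (p t w * Q t w).

Definition discounted_revenue (Om : Type) (R : realType) (beta : R) (T : nat)
    (p Q : nat -> Om -> R) (t : nat) (w : Om) : R :=
  \sum_(t <= s < T.+1) beta ^+ (s - t) * period_revenue p Q s w.

(* Main.v *)
Require Import Defs.
From HB Require Import structures.
From mathcomp Require Import all_boot all_order all_algebra.
From mathcomp Require Import all_classical all_reals all_analysis.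
From mathcomp Require Import measurable_realfun.
From mathcomp Require Import ring lra zify.

(* Let D_t be the total payment, M_t the supply and H_t = M_t - A_t the bidders'
   holdings.  The equilibrium price condition and feasibility give, almost
   surely, the accounting identity
     -p_t Q_t = D_t - p_t H_t + beta * pe_(t+1) * H_(t+1):
   either the price equals its discounted expected resale value, or all tokens
   are used for payment and H_(t+1) = 0.  Conditioning on the information at the
   beginning of period t turns D_t into k and p_t H_t into pe_t H_t, so that
   discounted sums telescope by backward induction.  Pulling H_t out of the
   conditional expectation is legitimate because token supplies are bounded by
   deterministic constants: at most M_t tokens are used for payment in period t.
   The identity holds only almost surely because pe_(t+1), a mere version of a
   conditional expectation, may be negative on a null set. *)

Set Implicit Arguments.
Unset Strict Implicit.
Unset Printing Implicit Defensive.

Import Order.TTheory GRing.Theory Num.Theory.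
Import numFieldNormedType.Exports.

Local Open Scope classical_set_scope.
Local Open Scope ring_scope.

(** * Measurability relative to a sub-sigma-algebra and integrals of bounded products *)

(** Makes the closure properties of measurable functions available for [G], viewed as the
    sigma-algebra of a measurable type. *)
Lemma measurable_wrtP d (Om : measurableType d) (R : realType)
    (G : set (set Om)) (X : Om -> R) :
  sigma_algebra [set: Om] G ->
  measurable_wrt G X <-> measurable_fun [set: g_sigma_algebraType G] X.
Proof.
move=> sG; have GE : <<s G >> = G by exact: sigma_algebra_id.
split=> [mX _ B mB|mX B mB].
  by rewrite setTI; apply: sub_sigma_algebra; exact: mX.
by have := mX measurableT B mB; rewrite setTI /measurable /= GE.
Qed.

Lemma measurable_wrt_sub d (Om : measurableType d) (R : realType)
    (G G' : set (set Om)) (X : Om -> R) :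
  G `<=` G' -> measurable_wrt G X -> measurable_wrt G' X.
Proof. by move=> GG' mX B mB; exact/GG'/mX. Qed.

Lemma measurable_wrt_fun d (Om : measurableType d) (R : realType)
    (G : set (set Om)) (X : Om -> R) :
  G `<=` measurable -> measurable_wrt G X -> measurable_fun setT X.
Proof. by move=> Gm mX _ B mB; rewrite setTI; exact/Gm/mX. Qed.

Lemma integrable_mul_bounded d (Om : measurableType d) (R : realType)
    (mu : {measure set Om -> \bar R}) (X H : Om -> R) (C : R) :
  mu.-integrable setT (EFin \o X) -> measurable_fun setT H ->
  (forall w, `|H w| <= C) -> mu.-integrable setT (EFin \o (X \* H)).
Proof.
move=> iX mH HC.
have mX : measurable_fun setT X by exact/measurable_EFinP/measurable_int/iX.
apply: (@le_integrable _ _ _ _ _ _ _ (fun w => C%:E * (EFin \o X) w)%E) => //.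
- exact/measurable_EFinP/measurable_funM.
- move=> w _; rewrite /= lee_fin normrM [leRHS]normrM mulrC ler_wpM2r//.
  exact: le_trans (HC w) (ler_norm C).
- exact: integrableZl.
Qed.

(* Subtracting from [H] half of its bound wherever [H] exceeds that half leaves
   the integral of [Z * H] unchanged and halves the bound on [H]. *)
Lemma Rintegral_mul_halving d (Om : measurableType d) (R : realType)
    (mu : {measure set Om -> \bar R}) (G : set (set Om)) (Z : Om -> R) :
  sigma_algebra [set: Om] G -> G `<=` measurable ->
  mu.-integrable setT (EFin \o Z) ->
  (forall E, G E -> \int[mu]_(w in E) Z w = 0) ->
  forall (m : nat) (H : Om -> R) (C : R) (E : set Om), G E ->
  measurable_wrt G H -> (forall w, 0 <= H w <= C) ->
  `|\int[mu]_(w in E) (Z w * H w)| <= C / 2 ^+ m * \int[mu]_(w in E) `|Z w|.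
Proof.
move=> sG Gm iZ Z0; elim=> [|m IH] H C E GE mH HC.
- have mE := Gm _ GE; have mH' := measurable_wrt_fun Gm mH.
  have HC' w : `|H w| <= C by have /andP[h0 hC] := HC w; rewrite ger0_norm.
  have iZH := integrable_mul_bounded iZ mH' HC'.
  have iZE : mu.-integrable E (EFin \o Z) by exact: integrableS iZ.
  have iZHE : mu.-integrable E (EFin \o (Z \* H)) by exact: integrableS iZH.
  rewrite expr0 divr1.
  apply: (le_trans (le_normr_Rintegral mE iZHE)).
  rewrite -RintegralZl//; last exact: integrable_norm.
  apply: le_Rintegral => //.
  + exact: (integrable_norm iZHE).
  + have := integrableZl mE C (integrable_norm iZE).
    by apply: eq_integrable.
  + by move=> w _; rewrite normrM mulrC ler_wpM2r.
- pose S := H @^-1` `[C / 2, +oo[.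
  have GS : G S by apply: mH; exact: measurable_itv.
  have GES : G (E `&` S).
    have [_ _ _ GI] := (sigma_algebraP (fun A _ => subsetT A)).1 sG.
    exact: GI.
  pose H' := fun w => H w - C / 2 * \1_S w.
  have mH' : measurable_wrt G H'.
    apply/(measurable_wrtP _ sG); apply: measurable_funB.
      exact/(measurable_wrtP _ sG).
    apply: measurable_funM => //; apply: measurable_indic.
    exact: sub_sigma_algebra.
  have H'C w : 0 <= H' w <= C / 2.
    have /andP[h0 hC] := HC w; rewrite /H' indicE.
    have [/set_mem|/negP wS] := boolP (w \in S).
      by rewrite /S /= in_itv /= andbT => hS; rewrite mulr1; apply/andP; split; lra.
    have : ~~ (C / 2 <= H w).
      by apply/negP => hS; apply/wS/mem_set; rewrite /S /= in_itv /= andbT.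
    by rewrite -ltNge mulr0 subr0 => hS; apply/andP; split; lra.
  have bnd (F : Om -> R) D : (forall w, 0 <= F w <= D) -> forall w, `|F w| <= D.
    by move=> FD w; have /andP[h0 hC] := FD w; rewrite ger0_norm.
  have mE := Gm _ GE.
  (* The two integrals differ by [C / 2] times the integral of [Z] over the intersection of [E] and
     [S], which is 0 because that event lies in [G]. *)
  have -> : \int[mu]_(w in E) (Z w * H w) = \int[mu]_(w in E) (Z w * H' w).
    have -> : \int[mu]_(w in E) (Z w * H w) =
        \int[mu]_(w in E) (Z w * H' w + C / 2 * (Z \_ S) w).
      apply: eq_Rintegral => w _; rewrite /H' patchE indicE.
      case: (w \in S) => /=; first by ring.
      (* Outside [S] the restriction of [Z] takes the default value [point], which is 0 in [R]. *)
      rewrite (_ : point = 0) //; ring.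
    have iZS : mu.-integrable E (EFin \o (Z \_ S)).
      rewrite -restrict_EFin; apply: (@integrableS _ _ _ _ setT) => //.
      apply/(integrable_mkcond _ (Gm _ GS)).1; apply: (integrableS measurableT) => //.
      exact: Gm.
    rewrite RintegralD//.
    + by rewrite RintegralZl// -Rintegral_mkcondr Z0// mulr0 addr0.
    + apply: (integrableS measurableT) => //.
      apply: (@integrable_mul_bounded _ _ _ _ _ _ (C / 2)) => //.
        exact: measurable_wrt_fun mH'.
      exact: bnd.
    + exact: (integrableZl mE (C / 2) iZS).
  have := IH H' (C / 2) E GE mH' H'C.
  by rewrite exprS invfM mulrA.
Qed.

(** The halving bound holds for every [m] and tends to 0. This replaces an approximation of [H] by
    simple functions. *)
Lemma Rintegral_mul_eq0 d (Om : measurableType d) (R : realType)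
    (mu : {measure set Om -> \bar R}) (G : set (set Om)) (Z H : Om -> R)
    (C : R) :
  sigma_algebra [set: Om] G -> G `<=` measurable ->
  mu.-integrable setT (EFin \o Z) ->
  (forall E, G E -> \int[mu]_(w in E) Z w = 0) ->
  measurable_wrt G H -> (forall w, 0 <= H w <= C) ->
  forall E, G E -> \int[mu]_(w in E) (Z w * H w) = 0.
Proof.
move=> sG Gm iZ Z0 mH HC E GE.
have hb m := Rintegral_mul_halving sG Gm iZ Z0 m GE mH HC.
apply/eqP; rewrite -normr_le0; apply/ler_addgt0Pl => e e0; rewrite addr0.
set K := \int[mu]_(w in E) `|Z w| in hb.
have : (fun m => C / 2 ^+ m * K) @ \oo --> (0 : R).
  rewrite -(mul0r K) -[X in X * K](mulr0 C).
  apply: cvgMl; apply: cvgMr.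
  rewrite (_ : (fun m => (2 ^+ m)^-1) = (fun m => (2^-1 : R) ^+ m)).
    by apply: cvg_expr; rewrite ger0_norm ?invr_ge0// invf_lt1 ?ltr1n.
  by apply/funext => m; rewrite exprVn.
move=> /cvgrPdist_le/(_ e e0)[N _ /(_ N (leqnn N))].
rewrite /= sub0r normrN => hN.
exact: le_trans (hb N) (le_trans (ler_norm _) hN).
Qed.

(** Links the extended-real equality in [is_cond_exp] to the real integrals of the halving argument;
    integrability keeps both sides finite, so [fine] loses nothing. *)
Lemma eq_integral_Rintegral_sub d (Om : measurableType d) (R : realType)
    (mu : {measure set Om -> \bar R}) (X Y : Om -> R) (E : set Om) :
  measurable E ->
  mu.-integrable setT (EFin \o X) -> mu.-integrable setT (EFin \o Y) ->
  (\int[mu]_(w in E) (Y w)%:E = \int[mu]_(w in E) (X w)%:E)%E <->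
  \int[mu]_(w in E) (X w - Y w) = 0.
Proof.
move=> mE iX iY.
have iXE : mu.-integrable E (EFin \o X) by exact: integrableS iX.
have iYE : mu.-integrable E (EFin \o Y) by exact: integrableS iY.
rewrite RintegralB//; split => [XY|/subr0_eq]; rewrite /Rintegral.
  by rewrite XY subrr.
have fX := integrable_fin_num mE iXE.
have fY := integrable_fin_num mE iYE.
by move=> XY; rewrite -(fineK fX) -(fineK fY) /= XY.
Qed.

(** * Calculus of conditional expectations *)

Lemma cond_exp_refl d (Om : measurableType d) (R : realType)
    (P : probability Om R) (G : set (set Om)) (Y : Om -> R) :
  P.-integrable setT (EFin \o Y) -> measurable_wrt G Y ->
  is_cond_exp P G Y Y.
Proof. by split. Qed.

Lemma cond_exp_tower d (Om : measurableType d) (R : realType)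
    (P : probability Om R) (G G' : set (set Om)) (X Y Z : Om -> R) :
  G `<=` G' -> is_cond_exp P G' X Y -> is_cond_exp P G Y Z ->
  is_cond_exp P G X Z.
Proof.
move=> GG' [iX _ _ YX] [_ iZ mZ ZY]; split=> // E GE.
by rewrite ZY// YX//; exact: GG'.
Qed.

Lemma cond_expD d (Om : measurableType d) (R : realType)
    (P : probability Om R) (G : set (set Om)) (X X' Y Y' : Om -> R) :
  sigma_algebra [set: Om] G -> G `<=` measurable ->
  is_cond_exp P G X Y -> is_cond_exp P G X' Y' ->
  is_cond_exp P G (fun w => X w + X' w) (fun w => Y w + Y' w).
Proof.
move=> sG Gm [iX iY mY YX] [iX' iY' mY' YX'].
split.
- by have := integrableD measurableT iX iX'; apply: eq_integrable.
- by have := integrableD measurableT iY iY'; apply: eq_integrable.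
- apply/(measurable_wrtP _ sG); apply: measurable_funD;
    exact/(measurable_wrtP _ sG).
- move=> E GE; have mE := Gm _ GE.
  by rewrite !integralD_EFin ?YX ?YX'//; exact: integrableS measurableT _ _ _.
Qed.

(** Taking out what is known: [X - Y] integrates to 0 over every event of [G], hence so does its
    product with the bounded [H]. *)
Lemma cond_exp_mul d (Om : measurableType d) (R : realType)
    (P : probability Om R) (G : set (set Om)) (X Y H : Om -> R) (C : R) :
  sigma_algebra [set: Om] G -> G `<=` measurable ->
  is_cond_exp P G X Y -> measurable_wrt G H -> (forall w, 0 <= H w <= C) ->
  is_cond_exp P G (fun w => X w * H w) (fun w => Y w * H w).
Proof.
move=> sG Gm [iX iY mY YX] mH HC.
have mH' := measurable_wrt_fun Gm mH.
have HC' w : `|H w| <= C by have /andP[h0 hC] := HC w; rewrite ger0_norm.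
have iXH := integrable_mul_bounded iX mH' HC'.
have iYH := integrable_mul_bounded iY mH' HC'.
split=> //.
- apply/(measurable_wrtP _ sG); apply: measurable_funM;
    exact/(measurable_wrtP _ sG).
- move=> E GE; apply/(eq_integral_Rintegral_sub (Gm _ GE) iXH iYH).
  under eq_Rintegral do rewrite -mulrBl.
  apply: (@Rintegral_mul_eq0 _ _ _ _ G (fun w => X w - Y w) H C) => //.
    by have := integrableB measurableT iX iY; apply: eq_integrable.
  by move=> D GD; apply/(eq_integral_Rintegral_sub (Gm _ GD) iX iY)/YX.
Qed.

Lemma cond_expZ d (Om : measurableType d) (R : realType)
    (P : probability Om R) (G : set (set Om)) (X Y : Om -> R) (c : R) :
  sigma_algebra [set: Om] G -> G `<=` measurable ->
  is_cond_exp P G X Y ->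
  is_cond_exp P G (fun w => c * X w) (fun w => c * Y w).
Proof.
move=> sG Gm [iX iY mY YX]; split.
- by have := integrableZl measurableT c iX; apply: eq_integrable.
- by have := integrableZl measurableT c iY; apply: eq_integrable.
- apply/(measurable_wrtP _ sG); apply: measurable_funM => //.
  exact/(measurable_wrtP _ sG).
- move=> E GE; have mE := Gm _ GE.
  under eq_integral do rewrite EFinM.
  under [in RHS]eq_integral do rewrite EFinM.
  rewrite !integralZl// ?YX//.
  + exact: (integrableS measurableT mE _ iX).
  + exact: (integrableS measurableT mE _ iY).
Qed.

(** Measurability of [X'] is asked separately because [P] may be incomplete; integrability passes
    over from [X]. *)
Lemma cond_exp_ae d (Om : measurableType d) (R : realType)
    (P : probability Om R) (G : set (set Om)) (X X' Y : Om -> R) :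
  G `<=` measurable -> measurable_fun setT X' ->
  {ae P, forall w, X' w = X w} -> is_cond_exp P G X Y ->
  is_cond_exp P G X' Y.
Proof.
move=> Gm mX' aeX [iX iY mY YX].
have mX : measurable_fun setT X by exact/measurable_EFinP/measurable_int/iX.
split=> //.
- have [_ iXoo] := integrableP _ _ _ iX.
  apply/integrableP; split; first exact/measurable_EFinP.
  rewrite (ae_eq_integral (fun w => `|(EFin \o X) w|)%E)//.
  + by apply: measurableT_comp => //; exact/measurable_EFinP.
  + by apply: measurableT_comp => //; exact/measurable_EFinP.
  + by apply: filterS aeX => w /= ->.
- move=> E GE; have mE := Gm _ GE; rewrite YX//.
  apply: ae_eq_integral => //.
  + by apply/measurable_EFinP; exact: measurable_funS mX.
  + by apply/measurable_EFinP; exact: measurable_funS mX'.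
  + by apply: filterS aeX => w /= ->.
Qed.

(** On the event [N] where [Y] is negative, the integral of [|Y|] is minus that of [X], hence at
    most 0. So [Y] vanishes almost everywhere on [N], which makes [N] null. *)
Lemma cond_exp_ge0 d (Om : measurableType d) (R : realType)
    (P : probability Om R) (G : set (set Om)) (X Y : Om -> R) :
  G `<=` measurable -> (forall w, 0 <= X w) -> is_cond_exp P G X Y ->
  {ae P, forall w, 0 <= Y w}.
Proof.
move=> Gm X0 [iX iY mY YX].
pose N := Y @^-1` `]-oo, 0[.
have GN : G N by apply: mY; exact: measurable_itv.
have mN := Gm _ GN.
have YN w : N w -> Y w < 0 by rewrite /N /= in_itv.
have iYN : P.-integrable N (EFin \o Y) by exact: integrableS iY.
have mYN := measurable_int _ iYN.
have : ae_eq P N (EFin \o Y) (cst 0%E).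
  apply/ae_eq_integral_abs => //.
  apply/eqP; rewrite eq_le integral_ge0 ?andbT//.
  have -> : (\int[P]_(w in N) `|(EFin \o Y) w| =
             \int[P]_(w in N) (- (Y w)%:E))%E.
    by apply: eq_integral => w /set_mem /YN Yw; rewrite /= ltr0_norm.
  rewrite integralN; last first.
    by rewrite fin_num_adde_defl// fin_numN integrable_neg_fin_num.
  by rewrite YX// oppe_le0 integral_ge0// => w _; rewrite lee_fin.
apply: filterS => w YN0; rewrite leNgt; apply/negP => Yw.
have /YN0 [] : N w by rewrite /N /= in_itv.
by move=> Y0; rewrite Y0 ltxx in Yw.
Qed.

(* If [c < D / M] then the whole supply is needed for payments, so market
   clearing and feasibility leave the bidders no tokens to carry over.  The
   convention [D / 0 = 0] is harmless: [p = 0] forces [D = 0]. *)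
Lemma equilibrium_revenueE (R : realFieldType) (A H Q q D p c : R) :
  0 < A + H -> 0 <= D -> 0 <= c -> Q + q = 0 -> 0 <= A + Q ->
  0 <= H + q - D / p -> p = Num.max (D / (A + H)) c ->
  - (p * Q) = D - p * H + c * (H + q - D / p).
Proof.
move=> M0 D0 c0 Qq AQ Z0 pE; have -> : Q = - q by lra.
have DM0 : 0 <= D / (A + H) by rewrite divr_ge0// ltW.
have [cD|Dc] := ltP c (D / (A + H)).
  have {pE} pE : p = D / (A + H) by rewrite pE; apply/max_idPl/ltW.
  have p0 : 0 < p by rewrite pE; exact: le_lt_trans cD.
  have DpE : D / p = A + H.
    have -> : D = p * (A + H) by rewrite pE divfK// gt_eqF.
    by rewrite mulrC mulKf// gt_eqF.
  have -> : H + q - D / p = 0 by lra.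
  have DE : D = p * (A + H) by rewrite pE divfK// gt_eqF.
  have qE : q = A by lra.
  by rewrite DE qE; ring.
have {pE} pE : p = c by rewrite pE; exact/max_idPr.
have pDE : p * (D / p) = D.
  have [p0|p0] := eqVneq p 0; last by rewrite mulrC divfK.
  have : D / (A + H) = 0 by apply/eqP; rewrite eq_le DM0 andbT -p0 pE.
  move/eqP; rewrite mulf_eq0 invr_eq0 (gt_eqF M0) orbF p0 => /eqP->.
  by rewrite mul0r.
by rewrite -pE mulrBr pDE; ring.
Qed.

Lemma discounted_revenue_recl (Om : Type) (R : realType) (beta : R) (T : nat)
    (p Q : nat -> Om -> R) (t : nat) (w : Om) : (t <= T)%N ->
  discounted_revenue beta T p Q t w =
  period_revenue p Q t w + beta * discounted_revenue beta T p Q t.+1 w.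
Proof.
move=> tT; rewrite /discounted_revenue big_ltn// subnn expr0 mul1r; congr +%R.
rewrite mulr_sumr; apply: eq_big_nat => s /andP[ts _].
by rewrite mulrA -exprS subnS prednK// subn_gt0.
Qed.

Unset Implicit Arguments.

Theorem proposition1
  (R : realType) (d : measure_display) (Om : measurableType d)
  (P : probability Om R)
  (T n : nat) (hn : (2 <= n)%N)
  (beta : R) (hbeta : 0 < beta < 1)
  (* information *)
  (Fil : nat -> set (set Om)) (hFil : filtration Fil)
  (* valuations: i.i.d. draws from an atomless F on [vlo, vhi] *)
  (vlo vhi : R) (F : probability (measurableTypeR R) R)
  (hFsupp : F [set` `[vlo, vhi]] = 1%E)
  (hFatomless : forall x : R, F [set x] = 0%E)
  (v : nat -> 'I_n -> {RV P >-> R})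
  (hvpos : forall t i w, (1 <= t <= T)%N -> 0 < v t i w)
  (hvlaw : forall t i (B : set R), (1 <= t <= T)%N -> measurable B ->
     distribution P (v t i) B = F B)
  (hvadapted : forall t i, (1 <= t <= T)%N -> measurable_wrt (Fil t) (v t i))
  (hvindep : independent_draws Fil T v)
  (* the auction: reservation price r, payments b, expected revenue k *)
  (r k : R)
  (hk : forall t, (1 <= t <= T)%N -> k = auction_revenue P (v t) r)
  (hr : forall t r', (1 <= t <= T)%N ->
     auction_revenue P (v t) r' <= auction_revenue P (v t) r)
  (b : nat -> 'I_n -> Om -> R)
  (hbadapted : forall t i, (1 <= t <= T)%N -> measurable_wrt (Fil t) (b t i))
  (hb0 : forall t w, (1 <= t <= T)%N -> 0 <= total_payment b t w)
  (hbval : forall t, (1 <= t <= T)%N ->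
     exists g : ('I_n -> R) -> R,
       forall w, total_payment b t w = g (fun i => v t i w))
  (hbk : forall t, (1 <= t <= T)%N ->
     is_cond_exp P (Fil t.-1) (total_payment b t) (fun=> k))
  (* monetary policy *)
  (tau sigma : nat -> R)
  (htau : forall t, (1 <= t <= T)%N -> -1 <= tau t)
  (hsigma : forall t, (1 <= t <= T)%N -> -1 <= sigma t)
  (* tokens: holdings A, a; net purchases Q, q; prices p *)
  (A Q p : nat -> Om -> R) (a q : nat -> 'I_n -> Om -> R)
  (hQadapted : forall t, (1 <= t <= T)%N -> measurable_wrt (Fil t) (Q t))
  (hqadapted : forall t i, (1 <= t <= T)%N -> measurable_wrt (Fil t) (q t i))
  (hpadapted : forall t, (1 <= t <= T)%N -> measurable_wrt (Fil t) (p t))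
  (hA0 : forall t w, (1 <= t <= T)%N -> 0 <= A t w)
  (ha0 : forall t i w, (1 <= t <= T)%N -> 0 <= a t i w)
  (hM0 : forall t w, (1 <= t <= T)%N -> 0 < supply A a t w)
  (M1 : R)
  (hA1 : forall w, A 1%N w = M1)
  (ha1 : forall i w, a 1%N i w = 0)
  (hclear : forall t w, (1 <= t <= T)%N -> Q t w + \sum_(i < n) q t i w = 0)
  (hQfeas : forall t w, (1 <= t <= T)%N -> 0 <= A t w + Q t w)
  (hqfeas : forall t i w, (1 <= t <= T)%N ->
     b t i w / p t w <= a t i w + q t i w)
  (haS : forall t i w, (1 <= t <= T)%N ->
     a t.+1 i w = (1 + tau t) * (a t i w + q t i w - b t i w / p t w))
  (hAS : forall t w, (1 <= t <= T)%N ->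
     A t.+1 w = (1 + tau t) *
       (A t w + Q t w + (1 + sigma t) * \sum_(i < n) (b t i w / p t w)))
  (* expected prices and the equilibrium price condition *)
  (pe : nat -> Om -> R)
  (hpe : forall t, (1 <= t <= T)%N -> is_cond_exp P (Fil t.-1) (p t) (pe t))
  (hpeT : forall w, pe T.+1 w = 0)
  (hp : forall t w, (1 <= t <= T)%N ->
     p t w = Num.max (total_payment b t w / supply A a t w)
                     (beta * (1 + tau t) * pe t.+1 w)) :
  forall t, (1 <= t <= T)%N ->
    is_cond_exp P (Fil t.-1)
      (discounted_revenue beta T p Q t)
      (fun w => (1 - beta ^+ (T - t + 1)) / (1 - beta) * k
                - pe t w * (supply A a t w - A t w)).
Proof.

(* Aggregate holdings: feasibility, deterministic bounds, measurability *)
have sG t : sigma_algebra [set: Om] (Fil t) by have [/(_ t)[]] := hFil.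
have Gm t : Fil t `<=` measurable by have [/(_ t)[]] := hFil.
pose D := total_payment b; pose M := supply A a.
pose H t w := \sum_(i < n) a t i w.
have ME t w : M t w = A t w + H t w by [].
have DpE t w : \sum_(i < n) (b t i w / p t w) = D t w / p t w.
  by rewrite /D /total_payment mulr_suml.
have HS t w : (1 <= t <= T)%N ->
    H t.+1 w = (1 + tau t) * (H t w + \sum_(i < n) q t i w - D t w / p t w).
  move=> ht; rewrite -DpE /H -big_split -sumrB mulr_sumr.
  by apply: eq_bigr => i _; exact: haS.
have Z0 t w : (1 <= t <= T)%N ->
    0 <= H t w + \sum_(i < n) q t i w - D t w / p t w.
  move=> ht; rewrite -DpE /H -big_split -sumrB; apply: sumr_ge0 => i _.
  by rewrite subr_ge0; exact: hqfeas.
have H0 t w : (1 <= t <= T)%N -> 0 <= H t w.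
  by move=> ht; apply: sumr_ge0 => i _; exact: ha0.
have DMp t w : (1 <= t <= T)%N -> D t w / M t w <= p t w.
  by move=> ht; rewrite hp// le_max lexx.
have p0 t w : (1 <= t <= T)%N -> 0 <= p t w.
  move=> ht; apply: le_trans (DMp t w ht).
  by apply: divr_ge0; [exact: hb0|exact/ltW/hM0].
have Dp_bounds t w : (1 <= t <= T)%N -> 0 <= D t w / p t w <= M t w.
  move=> ht; have M_gt0 := hM0 t w ht.
  rewrite divr_ge0 ?p0//=; last exact: hb0.
  have [->|pn0] := eqVneq (p t w) 0; first by rewrite invr0 mulr0 ltW.
  by rewrite ler_pdivrMr ?lt_def ?pn0 ?p0// mulrC -ler_pdivrMr// DMp.
have M_bounded t : (1 <= t <= T)%N -> exists C, forall w, M t w <= C.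
  elim: t => // -[_ _|t IH ht].
    exists M1 => w; rewrite ME hA1 /H big1 ?addr0// => i _; exact: ha1.
  have ht' : (1 <= t.+1 <= T)%N by rewrite /= ltnW.
  (* The supply grows to [1 + tau] times [M + sigma * (D / p)], and [D / p] lies between 0 and
     [M <= C]. *)
  have [C MC] := IH ht'; exists ((1 + tau t.+1) * (C + `|sigma t.+1| * C)) => w.
  have -> : M t.+2 w =
      (1 + tau t.+1) * (M t.+1 w + sigma t.+1 * (D t.+1 w / p t.+1 w)).
    by rewrite !ME hAS// HS// DpE; have := hclear t.+1 w ht'; nra.
  have tau0 := htau t.+1 ht'; have /andP[x0 xM] := Dp_bounds t.+1 w ht'.
  apply: ler_wpM2l; first by lra.
  apply: lerD; first exact: MC.
  apply: (le_trans (ler_norm _)); rewrite normrM (ger0_norm x0).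
  by apply: ler_wpM2l => //; exact: le_trans (MC w).
have H_bounded t : (1 <= t <= T)%N -> exists C, forall w, 0 <= H t w <= C.
  move=> ht; have [C MC] := M_bounded t ht; exists C => w.
  by rewrite H0//= (le_trans _ (MC w))// ME lerDr hA0.
(* Holdings at the start of period [t] are settled one period earlier, hence [Fil t.-1]; this is
   what lets [H t] leave the conditional expectation of [p t]. *)
have mH t : (1 <= t <= T)%N -> measurable_wrt (Fil t.-1) (H t).
  elim: t => // -[_ _|t IH ht].
    rewrite (_ : H 1%N = cst 0); first exact/(measurable_wrtP _ (sG _)).
    by apply/funext => w; rewrite /H big1.
  have ht' : (1 <= t.+1 <= T)%N by rewrite /= ltnW.
  have mD : measurable_fun [set: g_sigma_algebraType (Fil t.+1)] (D t.+1).
    by apply: measurable_sum => i; exact/(measurable_wrtP _ (sG _))/hbadapted.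
  (* The inverse of [p] becomes a real power, a measurable function of [p]; the two agree for
     [p >= 0], including at 0, where both are 0. *)
  have -> : H t.+2 = fun w => (1 + tau t.+1) *
      (H t.+1 w + \sum_(i < n) q t.+1 i w - D t.+1 w * p t.+1 w `^ (-1)).
    by apply/funext => w; rewrite HS// powR_inv1// p0.
  apply/(measurable_wrtP _ (sG _)); apply: measurable_funM => //.
  apply: measurable_funB; first apply: measurable_funD.
  - apply/(measurable_wrtP _ (sG _)); apply: measurable_wrt_sub (IH ht').
    by apply: hFil.2.
  - by apply: measurable_sum => i; exact/(measurable_wrtP _ (sG _))/hqadapted.
  - apply: measurable_funM => //.
    have /(measurable_wrtP _ (sG _)) mp := hpadapted t.+1 ht'.
    exact: (measurableT_comp (measurable_powR (-1)) mp).
have cond_exp_pH t : (1 <= t <= T)%N ->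
    is_cond_exp P (Fil t.-1) (fun w => p t w * H t w) (fun w => pe t w * H t w).
  move=> ht; have [C HC] := H_bounded t ht.
  by apply: (@cond_exp_mul _ _ _ _ _ _ _ _ C) => //; [exact: hpe|exact: mH].
(* The last period is treated apart: [pe T.+1] is given as 0, not as a conditional expectation. *)
have next_adapted t : (1 <= t <= T)%N ->
    P.-integrable setT (EFin \o (fun w => pe t.+1 w * H t.+1 w)) /\
    measurable_wrt (Fil t) (fun w => pe t.+1 w * H t.+1 w).
  move=> ht; have [tT|Tt] := ltnP t T.
    by have [] := cond_exp_pH t.+1 tT.
  have -> : (fun w => pe t.+1 w * H t.+1 w) = cst 0.
    apply/funext => w; have -> : t = T by lia.
    by rewrite hpeT mul0r.
  by split; [exact: integrable0|exact/(measurable_wrtP _ (sG _))].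
have pe_next_ge0 t : (1 <= t <= T)%N -> {ae P, forall w, 0 <= pe t.+1 w}.
  move=> ht; have [tT|Tt] := ltnP t T.
    apply: (cond_exp_ge0 (Gm t) _ (hpe t.+1 tT)) => w.
    by apply: p0.
  apply/aeW => w; have -> : t = T by lia.
  by rewrite hpeT.
have cst_integrable (c : R) : P.-integrable setT (EFin \o cst c).
  exact: finite_measure_integrable_cst.

(* Backward induction on the revenue formula *)
have main m t : (1 <= t)%N -> (t + m = T.+1)%N ->
    is_cond_exp P (Fil t.-1) (discounted_revenue beta T p Q t)
      (fun w => (1 - beta ^+ m) / (1 - beta) * k - pe t w * H t w).
  (* [m] counts the remaining periods; the base case lies just past the horizon, at [T.+1], where
     the revenue is an empty sum. *)
  elim: m t => [t t1|m IH t t1 tm].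
    rewrite addn0 => ->; rewrite expr0 subrr.
    have -> : discounted_revenue beta T p Q T.+1 = cst 0.
      by apply/funext => w; rewrite /discounted_revenue big_geq.
    have -> : (fun w => 0 / (1 - beta) * k - pe T.+1 w * H T.+1 w) = cst 0.
      by apply/funext => w; rewrite hpeT !mul0r subrr.
    apply: cond_exp_refl; first exact: cst_integrable.
    exact/(measurable_wrtP _ (sG _)).
  have ht : (1 <= t <= T)%N by lia.
  have tS : (t.+1 + m = T.+1)%N by lia.
  have {}IH := IH t.+1 isT tS.
  set c := (1 - beta ^+ m) / (1 - beta) in IH.
  have cE : (1 - beta ^+ m.+1) / (1 - beta) = 1 + beta * c.
    have b1 : 1 - beta != 0 by rewrite subr_eq0 eq_sym lt_eqF//; case/andP: hbeta.
    by rewrite /c exprS; field.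
  have [iN mN] := next_adapted t ht.
  have cD := hbk t ht; have cpH := cond_exp_pH t ht.
  have [iD _ _ _] := cD; have [ipH _ _ _] := cpH; have [idisc _ _ _] := IH.
  (* [U] is the right-hand side of the accounting identity. It is integrable term by term, and the
     revenue, almost surely equal to it, inherits this. *)
  pose U w := D t w - p t w * H t w + beta * (pe t.+1 w * H t.+1 w).
  have iU : P.-integrable setT (EFin \o U).
    have iB := integrableB measurableT iD ipH.
    have iZ := integrableZl measurableT beta iN.
    by have := integrableD measurableT iB iZ; apply: eq_integrable.
  have mU : measurable_wrt (Fil t) U.
    apply/(measurable_wrtP _ (sG _)); apply: measurable_funD.
      apply: measurable_funB.
        by apply: measurable_sum => i; exact/(measurable_wrtP _ (sG _))/hbadapted.
      apply: measurable_funM; first exact/(measurable_wrtP _ (sG _))/hpadapted.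
      apply/(measurable_wrtP _ (sG _)); apply: measurable_wrt_sub (mH t ht).
      by apply: hFil.2; lia.
    by apply: measurable_funM => //; exact/(measurable_wrtP _ (sG _)).
  have aeU : {ae P, forall w, discounted_revenue beta T p Q t w =
      U w + beta * discounted_revenue beta T p Q t.+1 w}.
    apply: filterS (pe_next_ge0 t ht) => w pe0.
    rewrite discounted_revenue_recl; last by lia.
    congr +%R; rewrite /period_revenue /U.
    have tau0 := htau t ht; have /andP[beta0 _] := hbeta.
    rewrite (@equilibrium_revenueE _ (A t w) (H t w) _
      (\sum_(i < n) q t i w) (D t w) _ (beta * (1 + tau t) * pe t.+1 w))//.
    (* The factor [1 + tau t] of the resale value turns unspent tokens into [H t.+1]. *)
    + by rewrite HS//; ring.
    + exact: hM0.
    + exact: hb0.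
    + by apply: mulr_ge0 => //; apply: mulr_ge0; [exact: ltW|lra].
    + exact: hclear.
    + exact: hQfeas.
    + exact: Z0.
    + exact: hp.
  (* What remains after adding [beta] times the induction hypothesis to [U]: the terms in
     [pe t.+1 * H t.+1] cancel. *)
  pose W w := D t w + -1 * (p t w * H t w) + beta * c * k.
  have cW : is_cond_exp P (Fil t) (discounted_revenue beta T p Q t) W.
    apply: cond_exp_ae aeU _ => //.
      rewrite (_ : discounted_revenue _ _ _ _ _ = (fun w =>
          - (p t w * Q t w) + beta * discounted_revenue beta T p Q t.+1 w)).
        apply: measurable_funD; first apply: measurableT_comp => //.
          apply: measurable_funM.
            exact: measurable_wrt_fun (hpadapted t ht).
          exact: measurable_wrt_fun (hQadapted t ht).
        apply: measurable_funM => //.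
        exact/measurable_EFinP/(measurable_int _ idisc).
      by apply/funext => w; rewrite discounted_revenue_recl//; lia.
    rewrite (_ : W = fun w => U w + beta * (c * k - pe t.+1 w * H t.+1 w)).
      exact: (cond_expD (sG t) (Gm t) (cond_exp_refl iU mU)
        (cond_expZ beta (sG t) (Gm t) IH)).
    by apply/funext => w; rewrite /W /U; ring.
  (* Passing from [Fil t] down to [Fil t.-1] replaces [D t] by [k] and [p t * H t] by
     [pe t * H t]. *)
  apply: (cond_exp_tower _ cW); first by apply: hFil.2; lia.
  rewrite cE (_ : (fun w => _) =
      fun w => k + -1 * (pe t w * H t w) + beta * c * k); last first.
    by apply/funext => w; ring.
  have cK : is_cond_exp P (Fil t.-1) (cst (beta * c * k)) (cst (beta * c * k)).
    apply: cond_exp_refl; first exact: cst_integrable.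
    exact/(measurable_wrtP _ (sG _)).
  have sG' := sG t.-1; have Gm' := Gm t.-1.
  have cDpH := cond_expD sG' Gm' cD (cond_expZ (-1) sG' Gm' cpH).
  exact: (cond_expD sG' Gm' cDpH cK).
move=> t ht.
have -> : (fun w => (1 - beta ^+ (T - t + 1)) / (1 - beta) * k -
      pe t w * (supply A a t w - A t w)) =
    (fun w => (1 - beta ^+ (T - t + 1)) / (1 - beta) * k - pe t w * H t w).
  by apply/funext => w; rewrite -/(M t w) ME [A t w + _]addrC addrK.
by apply: main; lia.
Qed.
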